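(* Let $\mathfrak{A}$ be the $\mathcal{L}$-structure with universe $2^{<\omega_1}$ described in the context, in the language $\mathcal{L}$ of size continuum, and let $T$ be the complete theory of $\mathfrak{A}$. Then $\mathfrak{A}$ is the unique (up to isomorphism) atomic model of $T$, and $\mathfrak{A}$ is not a prime model of $T$.
   Context: For $\eta \in 2^{<\omega_1}$, $\ell g(\eta)$ is the length (domain) of $\eta$. Let $\mathcal{L} = (U_\alpha, \pi_{\alpha\beta}, \boldsymbol{\eta} : \beta \leq \alpha < \omega_1, \eta \in 2^{<\omega_1})$, where each $U_\alpha$ is a unary relation symbol, each $\boldsymbol{\eta}$ is a unary function symbol (regarded as a map $U_{\ell g(\eta)} \to U_{\ell g(\eta)}$), and each $\pi_{\alpha\beta}$ is a unary function symbol (regarded as a map $U_\alpha \to U_\beta$). Formally these function symbols are total, with trivial values outside the indicated domain (say, acting as the identity there). The structure $\mathfrak{A}$ has universe $2^{<\omega_1}$ and: $U_\alpha$ is interpreted as $2^\alpha$; for $\tau \in 2^\alpha$ and $\beta \leq \alpha$, $\pi_{\alpha\beta}(\tau) = \tau\restriction_\beta$; for $\eta, \tau \in 2^\alpha$, $\boldsymbol{\eta}(\tau) = \eta \oplus \tau$, where addition is pointwise mod 2. A model $M$ is atomic if every finite tuple from $M$ has its type over $\emptyset$ isolated by a single formula; $M$ is prime if for every $N \equiv M$ there is an elementary embedding of $M$ into $N$. *)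

(* Defs.v *)
From HB Require Import structures.
From mathcomp Require Import all_boot all_order.
From mathcomp Require Import boolp classical_sets functions cardinality wochoice.

Set Implicit Arguments.
Unset Strict Implicit.
Unset Printing Implicit Defensive.

Local Open Scope classical_set_scope.
Local Open Scope card_scope.

(** * First-order logic with equality *)

Record language := Language {
  fsym : Type;
  far : fsym -> nat;
  rsym : Type;
  rar : rsym -> nat }.

Definition symbols (L : language) : Type := (fsym L + rsym L)%type.

Inductive term (L : language) (n : nat) :=
| Var of 'I_n
| App (f : fsym L) of ('I_(far f) -> term L n).

(* [formula L n] is the type of formulas with free variables among [x_0, .., x_(n-1)].
   Binding is de Bruijn style: [All] binds [x_0] and shifts the others by one.
   The missing connectives are the usual classical abbreviations. *)
Inductive formula (L : language) : nat -> Type :=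
| Bot n : formula L n
| Equal n of term L n & term L n : formula L n
| Rel n (r : rsym L) of ('I_(rar r) -> term L n) : formula L n
| Imp n of formula L n & formula L n : formula L n
| All n of formula L n.+1 : formula L n.

(* Empty carriers are allowed; they are never models of the theory of a nonempty structure. *)
Record structure (L : language) := Structure {
  carrier :> Type;
  finterp : forall f : fsym L, ('I_(far f) -> carrier) -> carrier;
  rinterp : forall r : rsym L, ('I_(rar r) -> carrier) -> Prop }.
Arguments finterp {L} s f _.
Arguments rinterp {L} s r _.

Definition vcons (T : Type) (n : nat) (x : T) (v : 'I_n -> T) (i : 'I_n.+1) : T :=
  oapp v x (unlift ord0 i).

Fixpoint eval (L : language) (M : structure L) (n : nat) (v : 'I_n -> M)
    (t : term L n) : M :=
  match t with
  | Var i => v i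
  | App f ts => finterp M f (fun j => eval v (ts j))
  end.

Fixpoint sat (L : language) (M : structure L) (n : nat) (phi : formula L n) :
    ('I_n -> M) -> Prop :=
  match phi in formula _ m return ('I_m -> M) -> Prop with
  | Bot _ => fun _ => False
  | Equal _ s t => fun v => eval v s = eval v t
  | Rel _ r ts => fun v => rinterp M r (fun j => eval v (ts j))
  | Imp _ p q => fun v => sat p v -> sat q v
  | All _ p => fun v => forall x : M, sat p (vcons x v)
  end.

Definition sentence (L : language) := formula L 0.

Definition holds (L : language) (M : structure L) (phi : sentence L) : Prop :=
  forall v : 'I_0 -> M, sat phi v.

Definition Th (L : language) (M : structure L) : set (sentence L) :=
  [set phi | holds M phi].

Definition models (L : language) (M : structure L) (T : set (sentence L)) : Prop :=
  T `<=` Th M.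

Definition elem_equiv (L : language) (M N : structure L) : Prop := Th M = Th N.

(* The type of a tuple over the empty set. *)
Definition tp (L : language) (M : structure L) (n : nat) (a : 'I_n -> M) :
    set (formula L n) :=
  [set phi | sat phi a].

(* [phi] entails [psi] modulo [T]. *)
Definition entails (L : language) (T : set (sentence L)) (n : nat)
    (phi psi : formula L n) : Prop :=
  forall N : structure L, models N T ->
  forall b : 'I_n -> N, sat phi b -> sat psi b.

Definition isolated (L : language) (T : set (sentence L)) (n : nat)
    (p : set (formula L n)) : Prop :=
  exists2 phi, p phi & forall psi, p psi -> entails T phi psi.

Definition atomic (L : language) (M : structure L) : Prop :=
  forall (n : nat) (a : 'I_n -> M), isolated (Th M) (tp a).

Definition elementary_embedding (L : language) (M N : structure L) (f : M -> N) : Prop :=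
  forall (n : nat) (phi : formula L n) (a : 'I_n -> M), sat phi a <-> sat phi (f \o a).

Definition prime_structure (L : language) (M : structure L) : Prop :=
  forall N : structure L, elem_equiv N M ->
  exists f : M -> N, elementary_embedding f.

Definition isomorphism (L : language) (M N : structure L) (f : M -> N) : Prop :=
  [/\ bijective f,
      forall (s : fsym L) (a : 'I_(far s) -> M),
        f (finterp M s a) = finterp N s (f \o a)
    & forall (r : rsym L) (a : 'I_(rar r) -> M),
        rinterp M r a <-> rinterp N r (f \o a)].

Definition isomorphic (L : language) (M N : structure L) : Prop :=
  exists f : M -> N, isomorphism f.

Definition atomic_model_of (L : language) (T : set (sentence L)) (M : structure L) : Prop :=
  models M T /\ atomic M.

Definition prime_model_of (L : language) (T : set (sentence L)) (M : structure L) : Prop :=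
  models M T /\ prime_structure M.

(** * The first uncountable ordinal *)

(* The ordinal omega_1 is represented by an arbitrary linear order of that order type:
   an uncountable well-order all of whose proper initial segments are countable. *)
Definition is_omega1 (d : Order.disp_t) (W : orderType d) : Prop :=
  [/\ well_order (<=%O : rel W),
      forall a : W, countable [set b : W | (b < a)%O]
    & ~ countable [set: W]].

(* Such orders exist: among the subsets of [nat], well-ordered by choice, keep those
   having only countably many predecessors. *)
Section Omega1Exists.
Let R : rel (set nat) := sval (well_ordering_principle (set nat)).
Let woR : well_order R := svalP (well_ordering_principle (set nat)).
Let chR : wo_chain R predT . Proof. by move=> A _; exact: woR. Qed.

Let small (x : set nat) : bool := `[< countable [set y | R y x && (y != x)] >].
Let W := {x : set nat | small x}.

Let leW : rel W := fun x y => R (val x) (val y).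
Fact omega1_display : Order.disp_t. Proof. exact: Order.Disp. Qed.

Let leR_total : total R.
Proof. by move=> x y; apply: (wo_chainW chR). Qed.
Let leR_anti : antisymmetric R.
Proof. by move=> x y; apply: (wo_chain_antisymmetric chR). Qed.
Let leR_min (P : set nat -> Prop) :
  (exists x, P x) -> exists2 x, P x & forall y, P y -> R x y.
Proof.
move=> [x Px]; have [|z [[Az lbz] _]] := woR (A := [pred u | `[<P u>]]).
  by exists x; apply/asboolP.
by exists z => [|y Py]; [apply/asboolP | apply: lbz; apply/asboolP].
Qed.
Let leR_trans : transitive R.
Proof.
move=> y x z Rxy Ryz; have [|m Pm min] := leR_min (P := fun u => [\/ u = x, u = y | u = z]).
  by exists x; constructor 1.
have Rm u : [\/ u = x, u = y | u = z] -> R m u by exact: min.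
case: Pm Rm => -> Rm; first by apply: Rm; constructor 3.
  have -> : x = y by apply: leR_anti; rewrite Rxy Rm //; constructor 1.
  exact: Ryz.
have <- : y = z by apply: leR_anti; rewrite Ryz Rm //; constructor 2.
exact: Rxy.
Qed.

Let leW_anti : antisymmetric leW.
Proof. by move=> x y /leR_anti/val_inj. Qed.
Let leW_trans : transitive leW.
Proof. by move=> y x z; exact: leR_trans. Qed.
Let leW_total : total leW.
Proof. by move=> x y; exact: leR_total. Qed.

#[local] HB.instance Definition _ := Choice.on W.
#[local] HB.instance Definition _ := Order.isOrder.Build omega1_display W
  (fun _ _ => erefl) (fun _ _ => erefl) (fun _ _ => erefl) leW_anti leW_trans leW_total.

Let cantor : ~ countable [set: set nat].
Proof.
move=> /countable_injP[f finj].
pose D := [set n | exists2 A, f A = n & ~ A n].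
have [DfD|nDfD] := pselect (D (f D)); last by apply: (nDfD); exists D.
have [A fA nA] := DfD; apply: nA.
by have -> : A = D by apply: finj; rewrite ?inE.
Qed.

Lemma omega1_exists : exists (d : Order.disp_t) (W : orderType d), is_omega1 W.
Proof.
exists omega1_display, W; split.
- apply: antisymmetric_well_order => [|A [a Aa]]; first exact: leW_anti.
  have [|m [[hm Am] min]] := @leR_min (fun u => exists h : small u, (exist _ u h : W) \in A).
    by case: a Aa => a sa Aa; exists a, sa.
  by exists (exist _ m hm); split=> // -[u hu] Au; apply: min; exists hu.
- move=> a; have /asboolP/countable_injP[f finj] := valP a.
  apply/countable_injP; exists (f \o val) => x y; rewrite !inE => xa ya fxy.
  apply/val_inj/finj => //; rewrite inE /=.
    by rewrite andbC eq_sym; exact: xa.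
  by rewrite andbC eq_sym; exact: ya.
- move=> /countable_injP[f finj].
  have cW (S : set (set nat)) : S `<=` [set x | small x] -> countable S.
    move=> Ss; apply/countable_injP.
    exists (fun x => oapp f 0 (insub x : option W)) => x y.
    rewrite !inE => /Ss sx /Ss sy; rewrite !insubT /= => /finj.
    by move=> /(_ _ _)/(congr1 val); apply; rewrite inE.
  have [al|/existsNP nal] := pselect (forall x, small x).
    by apply/cantor/cW => x _; exact: al.
  have [x nx min] := leR_min nal.
  apply: nx; apply/asboolP/cW => y /= /andP[Ryx yx].
  apply: contrapT => /min Rxy; case/eqP: yx.
  by apply: leR_anti; rewrite Ryx.
Qed.
End Omega1Exists.

(** * The structure on 2^(<omega_1) *)

Section Tree.
Context {d : Order.disp_t} (W : orderType d).

(* An element of [node] is a length [a : W] together with a map from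
   [a = {c | c < a}] to [2]. *)
Definition node : Type := {a : W & {c : W | (c < a)%O} -> bool}.

Definition lg (x : node) : W := tag x.

(* The value of [x] at [c]; [false] if [c] is not in the domain of [x]. *)
Definition value (x : node) (c : W) : bool := oapp (tagged x) false (insub c).

Definition mk_node (a : W) (f : W -> bool) : node :=
  Tagged (fun a : W => {c : W | (c < a)%O} -> bool)
         (fun c : {c : W | (c < a)%O} => f (val c)).

(* Used only for [b <= lg x]. *)
Definition restr (b : W) (x : node) : node := mk_node b (value x).

(* Used only for [lg x = lg y]. *)
Definition add_node (x y : node) : node :=
  mk_node (lg y) (fun c => value x c (+) value y c).

Inductive tree_fsym : Type :=
| Proj (a b : W) of (b <= a)%O
| Shift of node.

Inductive tree_rsym : Type := U of W.

Definition tree_language : language :=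
  {| fsym := tree_fsym; far := fun=> 1; rsym := tree_rsym; rar := fun=> 1 |}.

Definition tree_fun (s : tree_fsym) (x : node) : node :=
  match s with
  | Proj a b _ => if lg x == a then restr b x else x
  | Shift y => if lg x == lg y then add_node y x else x
  end.

Definition tree_rel (r : tree_rsym) (x : node) : Prop :=
  let: U a := r in lg x = a.

Definition tree : structure tree_language :=
  {| carrier := node;
     finterp := fun (s : fsym tree_language) x => tree_fun s (x ord0);
     rinterp := fun (r : rsym tree_language) x => tree_rel r (x ord0) |}.

End Tree.

(* Main.v *)
Require Import Defs.
From mathcomp Require Import all_boot all_order.
From mathcomp Require Import boolp classical_sets functions cardinality wochoice.

(** The structure on [2^(<omega_1)] is a tower of torsors: the level [U_a] is a copy of
    the group [2^a] on which the group acts by the named shifts, and the projections are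
    equivariant. Three facts follow from looking at the theory in this way.

    Atomicity and uniqueness. Translation by an element of [2^omega_1] is an automorphism,
    so all elements of one level have the same type; a tuple is given by its longest
    entry and by named functions applied to it, hence its type is isolated
    ([tree_atomic]). Conversely, each finite tuple of an atomic model realizes the type
    of a tuple of the tree, so the model is again a tower of torsors in which each level
    is a single orbit ([atomic_tree_like], [atomic_transitive]). Such a tower is
    isomorphic to the tree as soon as it has a branch, that is, a coherent choice of an
    origin in each level. A branch always exists ([coherent_branch]): pick origins [e_a]
    arbitrarily; the projection of [e_a] to [U_b] differs from [e_b] by a cocycle
    [eta_(a,b)], and correcting the [g]-th coordinate of [e_a] by the value of
    [eta_(a,g+1)] at [g] makes the choice coherent.

    The theory. [tree_like] collects the elementary properties that matter: levels,
    equivariance, freeness, surjectivity of the projections, and the fact that an interval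
    [b, a) with finitely many elements yields projections [U_a -> U_b] whose fibers are
    orbits. Any two tree-like structures are elementarily equivalent
    ([tree_like_elem_equiv]). This is a back-and-forth argument, one formula at a time:
    a formula names finitely many levels and shifts, and the positions are countable partial
    isomorphisms closed under these named functions and under a countable group of shifts.
    To match a new element of the level [a], first match its projection to the
    preceding named level [b]. If [b, a) is infinite, the fibers are uncountable and leave
    room for an unused image; if it is finite, then a used point of the fiber would put
    the new element in the domain already.

    Not prime. An elementary embedding of the tree sends the zero sequences to a branch,
    so it suffices to find a tree-like structure without branches. Take pairs of a
    node of length [a] and a finite-to-one function from [{g | g + omega <= a}] to the
    natural numbers ([twisted]). The domain does not change when [a] grows by a finite
    amount, which preserves the finite fibers; finite-to-one functions on countable sets
    extend, which gives surjective projections; and a branch would be a function on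
    [omega_1] whose fibers meet each initial segment in a finite set, which is absurd
    ([twisted_no_branch]).

    Finally, the language has size continuum since a node can be coded by the real that
    describes its length as a well-order on a set of natural numbers; the code determines the
    length because initial segments of a well-order are rigid ([node_code_rigid]). *)

Set Implicit Arguments.
Unset Strict Implicit.
Unset Printing Implicit Defensive.
Import Order.TTheory.

Local Open Scope classical_set_scope.
Local Open Scope card_scope.

(** * Back-and-forth and atomic models *)

Section Symbols.
Context (L : language).

Fixpoint term_syms n (t : term L n) : set (symbols L) :=
  match t with
  | Var _ => set0
  | App f ts => [set inl f] `|` [set s | exists j, term_syms (ts j) s]
  end.

Fixpoint form_syms n (phi : formula L n) : set (symbols L) :=
  match phi with
  | Bot _ => set0
  | Equal _ s t => term_syms s `|` term_syms t
  | Rel _ r ts => [set inr r] `|` [set s | exists j, term_syms (ts j) s]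
  | Imp _ p q => form_syms p `|` form_syms q
  | All _ p => form_syms p
  end.

Lemma finite_exists_ord T k (F : 'I_k -> set T) :
  (forall j, finite_set (F j)) -> finite_set [set s | exists j, F j s].
Proof.
move=> finF; apply: (@sub_finite_set _ _ (\bigcup_(j in [set: 'I_k]) F j)).
  by move=> s [j Fs]; exists j.
by apply: bigcup_finite => //; exact: finite_finset.
Qed.

Lemma finite_term_syms n (t : term L n) : finite_set (term_syms t).
Proof.
elim: t => [i|f ts IH] /=; first exact: finite_set0.
rewrite finite_setU; split; first exact: finite_set1.
exact: finite_exists_ord.
Qed.

(** What makes elementary equivalence local: a formula only sees a finite sublanguage. *)
Lemma finite_form_syms n (phi : formula L n) : finite_set (form_syms phi).
Proof.
elim: phi => {n} [n|n s t|n r ts|n p IHp q IHq|n p IHp] //=.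
- by rewrite finite_setU; split; exact: finite_term_syms.
- rewrite finite_setU; split; first exact: finite_set1.
  by apply: finite_exists_ord => j; exact: finite_term_syms.
- by rewrite finite_setU.
Qed.

End Symbols.

Section BackAndForth.
Context (L : language) (M N : structure L).

(** Preservation is only required for the symbols of [P], and the domain need not be
    closed under the other functions: [R] is a partial isomorphism of the reducts. *)
Record partial_iso (P : set (symbols L)) (R : M -> N -> Prop) : Prop := PartialIso {
  piso_eq : forall x x' y y', R x y -> R x' y' -> x = x' <-> y = y';
  piso_fun : forall f a b, P (inl f) -> (forall i, R (a i) (b i)) ->
    R (finterp M f a) (finterp N f b);
  piso_rel : forall r a b, P (inr r) -> (forall i, R (a i) (b i)) ->
    rinterp M r a <-> rinterp N r b }.

Lemma piso_eval P R n (t : term L n) a b : partial_iso P R -> term_syms t `<=` P ->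
  (forall i, R (a i) (b i)) -> R (eval a t) (eval b t).
Proof.
move=> pR + Rab; elim: t => [i|f ts IH] //= sP.
apply: piso_fun pR _ _ _ _ _ => //; first by apply: sP; left.
by move=> j; apply: IH => s ts_s; apply: sP; right; exists j.
Qed.

Lemma vcons_rel (R : M -> N -> Prop) n x y (a : 'I_n -> M) (b : 'I_n -> N) :
  R x y -> (forall i, R (a i) (b i)) -> forall i, R (vcons x a i) (vcons y b i).
Proof. by move=> Rxy Rab i; rewrite /vcons; case: unlift. Qed.

(** The relations of [RR] need not be finite: closing them under the functions of [P]
    makes atomic formulas immediate and leaves all the work to the extension property. *)
Lemma back_and_forth (P : set (symbols L)) (RR : set (M -> N -> Prop)) :
  (forall R, RR R -> partial_iso P R) ->
  (forall R x, RR R -> exists R' y, [/\ RR R', R' x y & forall u v, R u v -> R' u v]) ->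
  (forall R y, RR R -> exists R' x, [/\ RR R', R' x y & forall u v, R u v -> R' u v]) ->
  forall n (phi : formula L n) R (a : 'I_n -> M) (b : 'I_n -> N),
    form_syms phi `<=` P -> RR R -> (forall i, R (a i) (b i)) -> sat phi a <-> sat phi b.
Proof.
move=> pR forth back n phi.
elim: phi => {n} [n|n s t|n r ts|n p IHp q IHq|n p IHp] R a b //= sP RRR Rab.
- apply: (piso_eq (pR _ RRR)).
    by apply: (piso_eval (pR _ RRR)) Rab => u su; apply: sP; left.
  by apply: (piso_eval (pR _ RRR)) Rab => u su; apply: sP; right.
- apply: (piso_rel (pR _ RRR)); first by apply: sP; left.
  move=> i; apply: (piso_eval (pR _ RRR)) Rab => u su.
  by apply: sP; right; exists i.
- have Ep : sat p a <-> sat p b.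
    by apply: IHp RRR Rab => u su; apply: sP; left.
  have Eq : sat q a <-> sat q b.
    by apply: IHq RRR Rab => u su; apply: sP; right.
  by rewrite Ep Eq.
- split=> H x.
    have [R' [y [RR' Ryx RR'le]]] := back R x RRR.
    apply/(IHp R' (vcons y a)) => //; apply: vcons_rel => // i; exact: RR'le.
  have [R' [y [RR' Ryx RR'le]]] := forth R x RRR.
  apply/(IHp R' (vcons x a) (vcons y b)) => //; apply: vcons_rel => // i; exact: RR'le.
Qed.

Lemma isomorphism_sat (f : M -> N) : isomorphism f ->
  forall n (phi : formula L n) (a : 'I_n -> M), sat phi a <-> sat phi (f \o a).
Proof.
move=> [[g fK gK] ff fr] n phi a.
pose RR : set (M -> N -> Prop) := [set fun x y => f x = y].
apply: (@back_and_forth setT RR _ _ _ n phi (fun x y => f x = y)) => //.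
- move=> _ ->; split.
  + by move=> x x' _ _ <- <-; split=> [->|/(can_inj fK)].
  + by move=> s b c _ bc; rewrite ff; congr finterp; apply/funext => i; exact: bc.
  + move=> r b c _ bc; rewrite fr; suff -> : c = f \o b by [].
    by apply/funext => i; rewrite -bc.
- by move=> _ x ->; exists (fun x y => f x = y), (f x).
- by move=> _ y ->; exists (fun x y => f x = y), (g y).
Qed.

End BackAndForth.

Section Theories.
Context (L : language).

Fixpoint forall_closure n : formula L n -> sentence L :=
  match n with
  | 0 => id
  | n'.+1 => fun phi => forall_closure (All phi)
  end.

(** Passes from entailments between formulas with free variables to sentences of the
    theory, the only objects that transfer between models. *)
Lemma holds_forall_closure (M : structure L) n (phi : formula L n) :
  holds M (forall_closure phi) <-> forall a : 'I_n -> M, sat phi a.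
Proof.
elim: n phi => [|n IH] phi //=; rewrite IH /=; split=> [H a|H a x]; last exact: H.
have -> : a = vcons (a ord0) (a \o lift ord0); last exact: H.
by apply/funext => i; rewrite /vcons; case: unliftP => [j|] ->.
Qed.

Definition neg n (phi : formula L n) : formula L n := Imp phi (Bot L n).

Lemma Th_complete (M N : structure L) : models N (Th M) -> Th N = Th M.
Proof.
move=> NM; apply/seteqP; split=> // phi Nphi; apply: contrapT => nMphi.
have v0 (K : structure L) (v w : 'I_0 -> K) : v = w by apply/funext; case.
have : Th M (neg phi).
  by move=> v /= Mv; apply: nMphi => w; rewrite (v0 _ w v).
move/NM => Nneg; pose v (i : 'I_0) : N := False_rect _ (notF (ltn_ord i)).
by apply: (Nneg v); apply: Nphi.
Qed.

Lemma sat_realized (M N : structure L) n (phi : formula L n) (b : 'I_n -> N) :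
  models N (Th M) -> sat phi b -> exists a : 'I_n -> M, sat phi a.
Proof.
move=> /Th_complete NM Nb; apply: contrapT => /forallNP noM.
have : Th M (forall_closure (neg phi)) by apply/holds_forall_closure.
by rewrite -NM => /holds_forall_closure /(_ b) /(_ Nb).
Qed.

Lemma entails_Th (M : structure L) n (phi psi : formula L n) :
  (forall a : 'I_n -> M, sat phi a -> sat psi a) -> entails (Th M) phi psi.
Proof.
move=> Mphi N NM b Nphi.
have /NM : Th M (forall_closure (Imp phi psi)) by exact/holds_forall_closure.
by move=> /holds_forall_closure /(_ b); apply.
Qed.

(** The isolating formula of the type of [b] is consistent with the theory of [M], hence
    satisfied in [M]; isolation works over the same complete theory on both sides. *)
Lemma atomic_tuple_realized (M N : structure L) n (b : 'I_n -> N) :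
  models N (Th M) -> atomic N -> exists a : 'I_n -> M, tp a = tp b.
Proof.
move=> NM atN; have ThNM := Th_complete NM.
have [phi phib isol] := atN n b.
have [a phia] := sat_realized NM phib.
have Ma psi : tp b psi -> sat psi a.
  move=> /isol /(_ M); apply=> //; by rewrite ThNM.
exists a; apply/seteqP; split=> psi /=; last exact: Ma.
by move=> aps; apply: contrapT => nb; apply: (Ma (neg psi)) aps.
Qed.

End Theories.

Section AtomicModels.
Context (L : language).

Definition conj n (p q : formula L n) : formula L n := neg (Imp p (neg q)).

Lemma sat_conj (M : structure L) n (p q : formula L n) (v : 'I_n -> M) :
  sat (conj p q) v <-> sat p v /\ sat q v.
Proof.
split=> [/= H|[vp vq] /= H]; last exact: H.
by split; apply: contrapT => h; apply: H => // vp vq; apply: h.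
Qed.

Definition conj_ord k n (F : 'I_k -> formula L n) : formula L n :=
  foldr (fun i p => conj (F i) p) (neg (Bot L n)) (enum 'I_k).

Lemma sat_conj_ord (M : structure L) k n (F : 'I_k -> formula L n) (v : 'I_n -> M) :
  sat (conj_ord F) v <-> forall i, sat (F i) v.
Proof.
suff E s : sat (foldr (fun i p => conj (F i) p) (neg (Bot L n)) s) v <->
    forall i, i \in s -> sat (F i) v.
  by rewrite E; split=> H i; [apply: H; rewrite mem_enum|].
elim: s => [|i s IH]; first by split=> // _ /=.
rewrite [foldr _ _ _]/= sat_conj IH; split=> [[Fi Fs] j|H].
  by rewrite inE => /orP[/eqP->//|]; exact: Fs.
by split=> [|j js]; apply: H; rewrite inE ?eqxx // js orbT.
Qed.

(** The two tuples generate isomorphic substructures: [R] pairs the values of a term at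
    [a] and at [b]. All universal statements about finitely many elements transfer to [N]
    in this way, without being written as formulas. *)
Lemma atomic_partial_iso (M N : structure L) n (b : 'I_n -> N) :
  models N (Th M) -> atomic N -> exists (a : 'I_n -> M) (R : M -> N -> Prop),
    partial_iso setT R /\ forall i, R (a i) (b i).
Proof.
move=> NM atN; have [a ab] := atomic_tuple_realized b NM atN.
have satE phi : sat phi a <-> sat phi b by rewrite -[sat phi a]/(tp a phi) ab.
exists a, (fun x y => exists t, x = eval a t /\ y = eval b t); split; last first.
  by move=> i; exists (Var L i).
split=> [x x' y y' [t [-> ->]] [t' [-> ->]]|f u v _ /choice[ts tsP]|r u v _ /choice[ts tsP]].
- exact: (satE (Equal t t')).
- exists (App ts); split=> /=; congr finterp; apply/funext => j; by case: (tsP j).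
- have -> : u = (fun j => eval a (ts j)) by apply/funext => j; case: (tsP j).
  have -> : v = (fun j => eval b (ts j)) by apply/funext => j; case: (tsP j).
  exact: (satE (Rel ts)).
Qed.

End AtomicModels.

(** * Countable sets, the ordinal omega_1 and nodes *)

Section Countability.

Lemma countableU T (A B : set T) : countable A -> countable B -> countable (A `|` B).
Proof.
move=> cA cB; rewrite -bigcup2E; apply: bigcup_countable => // -[|[|i]] _ //=.
Qed.

Lemma countable_image T U (f : T -> U) (A : set T) : countable A -> countable (f @` A).
Proof. by apply: sub_countable; exact: card_image_le. Qed.

Lemma infinite_injection T (A : set T) : infinite_set A ->
  exists2 f : nat -> T, injective f & forall n, A (f n).
Proof.
move=> /infiniteP /card_leP[f].
exists (fun n => val (f (exist _ n (mem_set I)))) => [m n /val_inj|n].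
  by move=> fmn; have /(congr1 val) := 'inj_f (mem_set I) (mem_set I) fmn.
exact/set_mem/(valP (f _)).
Qed.

Lemma infinite_range T (f : nat -> T) : injective f -> infinite_set (range f).
Proof.
move=> finj; have /eq_finite_set -> := @inj_card_eq _ _ [set: nat] f (in2W finj).
exact: infinite_nat.
Qed.

Lemma injective_card_le T U (f : T -> U) : injective f -> [set: T] #<= [set: U].
Proof.
move=> finj; have := @inj_card_eq _ _ [set: T] f (in2W finj).
by rewrite card_eq_le => /andP[_ /card_le_trans]; apply; exact: card_leT.
Qed.

(** Cantor's diagonal argument, in the form that produces an unused element. *)
Lemma not_countable_inj T (A : set T) (f : (nat -> bool) -> T) : injective f ->
  countable A -> exists X, ~ A (f X).
Proof.
move=> finj /countable_injP[g ginj]; apply: contrapT => /forallNP AfX.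
have {}AfX X : f X \in A by rewrite inE; apply: contrapT.
have hinj : injective (g \o f) by move=> X Y /= /(ginj _ _ (AfX X) (AfX Y))/finj.
pose D n : bool := `[< exists2 X, g (f X) = n & ~~ X n >].
have [DD|nDD] := boolP (D (g (f D))).
  have /asboolP[X /hinj -> nD] := DD; by rewrite DD in nD.
by case/negP: (nDD); apply/asboolP; exists D.
Qed.

(** The finite sums of an enumeration form a subgroup that is countable since there are
    countably many finite lists of indices. *)
Lemma countable_xor_group T (A : set (T -> bool)) : countable A ->
  exists G : set (T -> bool), [/\ countable G, A `<=` G, G (fun=> false) &
    forall f g, G f -> G g -> G (fun x => f x (+) g x)].
Proof.
move=> /countable_injP[k kinj].
have [h Ah] : exists h : nat -> T -> bool, A `<=` range h.
  have /choice[h hP] n : exists f, forall g, A g -> k g = n -> f = g.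
    have [[g [Ag kg]]|no] := pselect (exists g, A g /\ k g = n).
      by exists g => g' Ag' kg'; apply: kinj; rewrite ?inE // kg.
    by exists (fun=> false) => g Ag kg; case: no; exists g.
  by exists h => g Ag; exists (k g) => //; exact: hP.
pose lin (s : seq nat) x := \big[addb/false]_(i <- s) h i x.
exists (range lin); split.
- by apply: countable_image; exact: countableP.
- move=> _ /Ah[n _ <-]; exists [:: n] => //.
  by apply/funext => x; rewrite /lin big_seq1.
- by exists [::] => //; apply/funext => x; rewrite /lin big_nil.
- move=> _ _ [s _ <-] [t _ <-]; exists (s ++ t) => //.
  by apply/funext => x; rewrite /lin big_cat.
Qed.

Lemma xor_group_finite_support (T : choiceType) (G : set (T -> bool)) (f : T -> bool) :
  G (fun=> false) -> (forall f g, G f -> G g -> G (fun x => f x (+) g x)) ->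
  finite_set [set x | f x] -> (forall x, f x -> G (pred1 x)) -> G f.
Proof.
move=> G0 GD /finite_seqP[s fs] Gx.
have {fs} fE x : f x = (x \in undup s).
  by rewrite mem_undup; apply/idP/idP; move: (congr1 (fun A => A x) fs) => /= ->.
have {Gx} : forall x, x \in undup s -> G (pred1 x) by move=> x; rewrite -fE; exact: Gx.
have -> : f = (fun x => x \in undup s) by apply/funext.
move: (undup_uniq s); elim: (undup s) => [|y t IH] /=.
  by move=> _ _; have -> : (fun x : T => x \in [::]) = (fun=> false) by apply/funext.
move=> /andP[yt ut] Gt.
have -> : (fun x => x \in y :: t) = (fun x => pred1 y x (+) (x \in t)).
  apply/funext => x /=; rewrite inE; case: eqP => [->|//]; by rewrite (negPf yt).
apply: GD; first by apply: Gt; rewrite mem_head.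
by apply: IH => // x xt; apply: Gt; rewrite inE xt orbT.
Qed.

End Countability.

Section Omega1.
Context {d : Order.disp_t} (W : orderType d) (hW : is_omega1 W).

Lemma omega1_min (P : W -> Prop) :
  (exists x, P x) -> exists2 m, P m & forall y, P y -> (m <= y)%O.
Proof.
case: hW => wo _ _ [x Px]; have [|m [[Pm lb] _]] := wo [pred u | `[<P u>]].
  by exists x; apply/asboolP.
by exists m => [|y Py]; [exact/asboolP | apply: lb; apply/asboolP].
Qed.

(** Regularity of [omega_1]: an unbounded countable set would write [omega_1] as a
    countable union of countable initial segments. *)
Lemma omega1_bounded (A : set W) : countable A -> exists a, forall x, A x -> (x < a)%O.
Proof.
case: hW => _ segW uncW cA; apply: contrapT => /forallNP unb; apply: uncW.
apply: (@sub_countable _ _ _ (\bigcup_(x in A) [set b | (b <= x)%O])).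
  apply: subset_card_le => b _; have /existsNP[x /not_implyP[Ax /negP]] := unb b.
  by rewrite -leNgt => bx; exists x.
apply: bigcup_countable => // x Ax.
apply: (@sub_countable _ _ _ ([set b | (b < x)%O] `|` [set x])).
  by apply: subset_card_le => b /=; rewrite le_eqVlt => /orP[/eqP|]; [right|left].
by apply: countableU => //; exact: countable1.
Qed.

Lemma omega1_bottom : exists o : W, forall a, (o <= a)%O.
Proof.
have [|o _ min] := @omega1_min (fun=> True); last by exists o => a; exact: min.
by have [a _] := omega1_bounded (countable0 W); exists a.
Qed.

Lemma omega1_succ (a : W) : exists2 b, (a < b)%O & forall c, (a < c)%O -> (b <= c)%O.
Proof.
apply: (@omega1_min (fun c => (a < c)%O)).
by have [b lb] := omega1_bounded (countable1 a); exists b; apply: lb.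
Qed.

Lemma omega1_infinite : infinite_set [set: W].
Proof. by case: hW => _ _ uncW /finite_set_countable /uncW. Qed.

Lemma infinite_set_bounded (A : set W) : infinite_set A ->
  exists a, infinite_set (A `&` [set b | (b < a)%O]).
Proof.
move=> /infinite_injection[f finj Af].
have [a lba] : exists a, forall x, range f x -> (x < a)%O.
  by apply: omega1_bounded; apply: countable_image; exact: countableP.
exists a; apply: sub_infinite_set (infinite_range finj).
by move=> _ [n _ <-]; split; [exact: Af | apply: lba; exists n].
Qed.

End Omega1.

Section Nodes.
Context {d : Order.disp_t} (W : orderType d).
Implicit Types (x y : node W) (a b c : W).

Lemma value_mk a f c : value (mk_node a f) c = (c < a)%O && f c.
Proof.
rewrite /value /mk_node /=; case: insubP => [u ca <-|/negPf->] //=.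
by rewrite (valP u).
Qed.

Lemma mk_node_eq a f g : (forall c, (c < a)%O -> f c = g c) -> mk_node a f = mk_node a g.
Proof.
by move=> fg; congr Tagged; apply/funext => c; exact: fg (valP c).
Qed.

Lemma mk_nodeK x : mk_node (lg x) (value x) = x.
Proof.
case: x => a f; congr Tagged; apply/funext => c; rewrite /value /= /lg /=.
by rewrite valK.
Qed.

Lemma node_ext x y :
  lg x = lg y -> (forall c, (c < lg x)%O -> value x c = value y c) -> x = y.
Proof. by move=> lxy vxy; rewrite -(mk_nodeK x) -(mk_nodeK y) -lxy; exact: mk_node_eq. Qed.

Lemma mk_node_inj a f g : mk_node a f = mk_node a g -> forall c, (c < a)%O -> f c = g c.
Proof. by move=> fg c ca; move: (congr1 (fun x => value x c) fg); rewrite !value_mk ca. Qed.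

(** Put an arbitrary 0-1 sequence on an infinite countable part of [b, a), and zeros
    elsewhere: these nodes have a trivial projection to the level [b], so that they act on
    the fibers over that level. *)
Lemma continuum_many_nodes a b : infinite_set [set c : W | (b <= c)%O /\ (c < a)%O] ->
  exists2 F : (nat -> bool) -> W -> bool, injective (fun X => mk_node a (F X)) &
    forall X c, (c < b)%O -> F X c = false.
Proof.
move=> /infinite_injection[p pinj pab].
exists (fun X c => `[< exists2 n, p n = c & X n >]) => [X Y /mk_node_inj FXY|X c cb].
  apply/funext => n; have [_ pna] := pab n.
  have valE (Z : nat -> bool) : `[< exists2 m, p m = p n & Z m >] = Z n.
    by apply/asboolP/idP => [[m /pinj ->]//|Zn]; exists n.
  by rewrite -(valE X) -(valE Y); exact: FXY.
apply/negbTE/asboolP => -[n pn _]; have [bpn _] := pab n.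
by move: cb; rewrite -pn ltNge bpn.
Qed.

End Nodes.

(** * Tree-like structures and their elementary equivalence *)

Section TreeLike.
Context {d : Order.disp_t} (W : orderType d).
Local Notation L := (tree_language W).

Definition lvl (M : structure L) (a : W) (x : M) : Prop :=
  @rinterp L M (U a) (fun=> x).
Definition proj (M : structure L) (a b : W) (h : (b <= a)%O) (x : M) : M :=
  @finterp L M (Proj h) (fun=> x).
Definition shift (M : structure L) (e : node W) (x : M) : M :=
  @finterp L M (Shift e) (fun=> x).
Definition act (M : structure L) (a : W) (f : W -> bool) (x : M) : M :=
  shift (mk_node a f) x.

(** The part of the theory that determines it. In [finite_gap] and [lvl_bottom] the fibers
    of the projections are bounded: they are the only obstacles to adding extra orbits. *)
Record tree_like (M : structure L) : Prop := TreeLike {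
  lvl_inj : forall (x : M) a b, lvl a x -> lvl b x -> a = b;
  lvl_inhab : forall a, exists x : M, lvl a x;
  proj_out : forall a b (h : (b <= a)%O) (x : M), ~ lvl a x -> proj h x = x;
  lvl_proj : forall a b (h : (b <= a)%O) (x : M), lvl a x -> lvl b (proj h x);
  proj_id : forall a (h : (a <= a)%O) (x : M), lvl a x -> proj h x = x;
  proj_comp : forall a b c (hab : (b <= a)%O) (hbc : (c <= b)%O) (hac : (c <= a)%O) (x : M),
    lvl a x -> proj hbc (proj hab x) = proj hac x;
  proj_surj : forall a b (h : (b <= a)%O) (y : M), lvl b y ->
    exists2 x : M, lvl a x & proj h x = y;
  shift_out : forall e (x : M), ~ lvl (lg e) x -> shift e x = x;
  lvl_act : forall a f (x : M), lvl a x -> lvl a (act a f x);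
  act0 : forall a (x : M), lvl a x -> act a (fun=> false) x = x;
  actD : forall a f g (x : M), lvl a x ->
    act a f (act a g x) = act a (fun c => f c (+) g c) x;
  act_free : forall a f g (x : M), lvl a x -> act a f x = act a g x ->
    mk_node a f = mk_node a g;
  proj_act : forall a b (h : (b <= a)%O) f (x : M), lvl a x ->
    proj h (act a f x) = act b f (proj h x);
  finite_gap : forall a b (h : (b <= a)%O) (x y : M),
    finite_set [set c : W | (b <= c)%O /\ (c < a)%O] ->
    lvl a x -> lvl a y -> proj h x = proj h y -> exists f, y = act a f x;
  lvl_bottom : forall o (x y : M), (forall a : W, (o <= a)%O) -> lvl o x -> lvl o y -> x = y }.

Lemma act_out (M : structure L) a f (x : M) : tree_like M -> ~ lvl a x -> act a f x = x.
Proof. by move=> tM xa; apply: (shift_out tM). Qed.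

Lemma act_eq (M : structure L) a f g (x : M) :
  (forall c, (c < a)%O -> f c = g c) -> act a f x = act a g x.
Proof. by move=> /mk_node_eq fg; rewrite /act fg. Qed.

Lemma actK (M : structure L) a f (x : M) : tree_like M -> act a f (act a f x) = x.
Proof.
move=> tM; have [xa|xa] := pselect (lvl a x); last by rewrite !(act_out _ tM).
rewrite (actD tM) //; under eq_fun do rewrite addbb; exact: act0.
Qed.

Lemma vec1 T (v : 'I_1 -> T) : v = (fun=> v ord0).
Proof. by apply/funext => i; rewrite (ord1 i). Qed.

End TreeLike.

Section Fibers.
Context {d : Order.disp_t} (W : orderType d) (N : structure (tree_language W)).
Context (tN : tree_like N).

(** The shifts that vanish below [b] act freely on the fiber over [y], and there are
    uncountably many of them; this is where unused images come from. *)
Lemma fiber_uncountable a b (h : (b <= a)%O) (y : N) (A : set N) :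
  infinite_set [set c : W | (b <= c)%O /\ (c < a)%O] -> lvl b y -> countable A ->
  exists z : N, [/\ lvl a z, proj h z = y & ~ A z].
Proof.
move=> /continuum_many_nodes[F Finj F0] yb cA; have [z za zy] := proj_surj tN h yb.
have actinj : injective (fun X => act a (F X) z) by move=> X Y /(act_free tN za) /Finj.
have [X AX] := not_countable_inj actinj cA; exists (act a (F X) z); split=> //.
  exact: (lvl_act tN).
rewrite (proj_act tN) // zy -[RHS](act0 tN yb); apply: act_eq => c; exact: F0.
Qed.

End Fibers.

Section Maximum.
Context {d : Order.disp_t} (W : orderType d).

Lemma finite_maximum (A : set W) : finite_set A -> A !=set0 ->
  exists2 m, A m & forall x, A x -> (x <= m)%O.
Proof.
move=> /finite_seqP[s ->] {A} [x0 xs]; exists (\big[Order.max/x0]_(x <- s) x).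
  rewrite /= big_seq; elim/big_ind: _ => // x y xs' ys'; by case: leP.
move=> x /=; elim: s {xs} => [//|y s IH]; rewrite inE big_cons le_max.
by case/orP=> [/eqP->|/IH ->]; rewrite ?lexx ?orbT.
Qed.

End Maximum.

Section Extension.
Context {d : Order.disp_t} (W : orderType d) (hW : is_omega1 W).
Local Notation L := (tree_language W).
Context (o : W) (o_min : forall a, (o <= a)%O).
Context (S : set W) (finS : finite_set S) (So : S o).
Context (G : set (W -> bool)) (countG : countable G) (G0 : G (fun=> false)).
Context (GD : forall f g, G f -> G g -> G (fun c => f c (+) g c)).
Context (G1 : forall a c, S a -> (c < a)%O -> G (pred1 c)).

(** A partial isomorphism for the reduct to the levels of [S] and the shifts in the group
    [G], with countable domain and range, so that uncountable fibers always contain unused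
    points. The group has to contain the shifts by one coordinate, since otherwise two
    elements in the same finite fiber could fail to be related by a named function. *)
Record countable_iso (M N : structure L) (R : M -> N -> Prop) : Prop := CountableIso {
  ciso_eq : forall x x' y y', R x y -> R x' y' -> x = x' <-> y = y';
  ciso_lvl : forall a x y, S a -> R x y -> lvl a x <-> lvl a y;
  ciso_proj : forall a b (h : (b <= a)%O) x y, S a -> S b -> R x y ->
    R (proj h x) (proj h y);
  ciso_act : forall a f x y, S a -> G f -> R x y -> R (act a f x) (act a f y);
  ciso_bottom : forall x y, lvl o x -> lvl o y -> R x y;
  ciso_dom : countable [set x | exists y, R x y];
  ciso_ran : countable [set y | exists x, R x y] }.

Lemma ciso_sym (M N : structure L) (R : M -> N -> Prop) :
  countable_iso R -> countable_iso (fun y x => R x y).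
Proof.
case=> Req Rlvl Rproj Ract Rbot Rdom Rran; split=> //.
- by move=> y y' x x' Rxy Rxy'; rewrite (Req _ _ _ _ Rxy Rxy').
- by move=> a y x Sa Rxy; rewrite (Rlvl _ _ _ Sa Rxy).
- by move=> a b h y x Sa Sb; exact: Rproj.
- by move=> a f y x Sa Gf; exact: Ract.
- by move=> y x yo xo; exact: Rbot.
Qed.

Context (M N : structure L) (tM : tree_like M) (tN : tree_like N).

(** The initial position: the bottom levels are singletons. *)
Lemma ciso_start : countable_iso (fun (x : M) (y : N) => lvl o x /\ lvl o y).
Proof.
have sub1 (K : structure L) (A : set K) : tree_like K -> (forall x, A x -> lvl o x) -> countable A.
  move=> tK Ao; have [x xo] := lvl_inhab tK o.
  apply: sub_countable (countable1 x); apply: subset_card_le => y /Ao yo.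
  exact: (lvl_bottom tK o_min).
split.
- move=> x x' y y' [xo yo] [xo' yo'].
  by split=> _; [apply: (lvl_bottom tN o_min)|apply: (lvl_bottom tM o_min)].
- move=> a x y _ [xo yo]; split=> ha.
    by rewrite (lvl_inj tM ha xo).
  by rewrite (lvl_inj tN ha yo).
- move=> a b h x y _ _ [xo yo]; have [ao|nao] := eqVneq a o; last first.
    by rewrite !proj_out // => ha; case/eqP: nao;
      [exact: (lvl_inj tN ha yo)|exact: (lvl_inj tM ha xo)].
  have bo : b = o by apply/le_anti; rewrite o_min -{1}ao h.
  by subst a b; split; apply: lvl_proj.
- move=> a f x y _ _ [xo yo]; have [ao|nao] := eqVneq a o; last first.
    by rewrite !act_out // => ha; case/eqP: nao;
      [exact: (lvl_inj tN ha yo)|exact: (lvl_inj tM ha xo)].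
  by subst a; split; apply: lvl_act.
- by [].
- by apply: (sub1 M) => // x [y []].
- by apply: (sub1 N) => // y [x []].
Qed.

(** The named functions are trivial outside of the named levels, so that an element there
    can be matched with any unused element of that kind; a level with uncountably many
    elements above all the named ones provides one. *)
Lemma extend_unnamed (R : M -> N -> Prop) c : countable_iso R -> (forall a, S a -> ~ lvl a c) ->
  (forall y, ~ R c y) ->
  exists (R' : M -> N -> Prop) y, [/\ countable_iso R', R' c y & forall u v, R u v -> R' u v].
Proof.
move=> gR Sc nRc.
have [e [Se nRe]] : exists e : N, (forall a, S a -> ~ lvl a e) /\ forall x, ~ R x e.
  have [m lbm] := omega1_bounded hW (finite_set_countable finS).
  have [b] := infinite_set_bounded hW (omega1_infinite hW); rewrite setTI => infb.
  pose a := Order.max m b; have [y yo] := lvl_inhab tN o.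
  have [|e [ea _ nRe]] := fiber_uncountable tN (o_min a) _ yo (ciso_ran gR).
    apply: sub_infinite_set infb => x /= xb; split; first exact: o_min.
    by rewrite lt_max xb orbT.
  exists e; split=> [a' Sa' ea'|x Rxe]; last by apply: nRe; exists x.
  by have := lbm _ Sa'; rewrite -(lvl_inj tN ea ea') ltNge le_max lexx.
exists (fun x y => R x y \/ (x = c /\ y = e)), e; split; [|by right|by left].
case: gR => Req Rlvl Rproj Ract Rbot Rdom Rran; split.
- move=> x x' y y' [Rxy|[-> ->]] [Rxy'|[-> ->]].
  + exact: Req.
  + by split=> E; subst; [case: (nRc _ Rxy)|case: (nRe _ Rxy)].
  + by split=> E; subst; [case: (nRc _ Rxy')|case: (nRe _ Rxy')].
  + by [].
- move=> a x y Sa [Rxy|[-> ->]]; first exact: Rlvl.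
  by split=> [/(Sc _ Sa)|/(Se _ Sa)].
- move=> a b h x y Sa Sb [Rxy|[-> ->]]; first by left; exact: Rproj.
  by right; rewrite !proj_out //; [exact: Se|exact: Sc].
- move=> a f x y Sa Gf [Rxy|[-> ->]]; first by left; exact: Ract.
  by right; rewrite !act_out //; [exact: Se|exact: Sc].
- by move=> x y xo yo; left; exact: Rbot.
- apply: sub_countable (countableU Rdom (countable1 c)); apply: subset_card_le.
  by move=> x [y [Rxy|[-> _]]]; [left; exists y|right].
- apply: sub_countable (countableU Rran (countable1 e)); apply: subset_card_le.
  by move=> y [x [Rxy|[_ ->]]]; [left; exists x|right].
Qed.

(** The heart of the argument. Here [b] is the predecessor of [a] among the named levels,
    and [c] is a new point whose projection to [b] is matched with [y]. Any unused [e]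
    in the fiber over [y] is a correct image, because the closure of [c] only adds the
    points [act a f c] of the level [a]. *)
Lemma extend_next (R : M -> N -> Prop) a b (h : (b <= a)%O) c y : countable_iso R ->
  S a -> S b -> b != a -> (forall e, S e -> (e < a)%O -> (e <= b)%O) ->
  lvl a c -> R (proj h c) y ->
  exists (R' : M -> N -> Prop) y, [/\ countable_iso R', R' c y & forall u v, R u v -> R' u v].
Proof.
move=> gR Sa Sb ba pred_b ca Rcy.
have [[y' Rcy']|/forallNP nRc] := pselect (exists y', R c y').
  by exists R, y'.
have yb : lvl b y by apply/(ciso_lvl gR Sb Rcy); exact: lvl_proj.
have [e [ea ey nRe]] : exists e : N, [/\ lvl a e, proj h e = y & forall x, ~ R x e].
  have [fin|/fiber_uncountable inf] :=
    pselect (finite_set [set c : W | (b <= c)%O /\ (c < a)%O]); last first.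
    have [e [ea ey nRe]] := inf _ tN h _ _ yb (ciso_ran gR).
    by exists e; split=> // x Rxe; apply: nRe; exists x.
  have [e ea ey] := proj_surj tN h yb; exists e; split=> // x Rxe.
  have xa : lvl a x by apply/(ciso_lvl gR Sa Rxe).
  have pxc : proj h x = proj h c.
    by apply/(ciso_eq gR (ciso_proj gR h Sa Sb Rxe) Rcy).
  (* A used point [e] of a finite fiber comes from a point [x] of the fiber of [c];
     then [c] is a translate of [x] by finitely many coordinates, hence in the domain. *)
  have [f cf] := finite_gap tM fin xa ca pxc.
  have f0 : mk_node b f = mk_node b (fun=> false).
    have pb : lvl b (proj h x) by exact: lvl_proj.
    apply: (act_free tM pb); rewrite (act0 tM) // -(proj_act tM) // -cf.
    by rewrite pxc.
  case: (nRc (act a f e)); rewrite cf.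
  rewrite (@act_eq _ _ M a f (value (mk_node a f))); last first.
    by move=> k ka; rewrite value_mk ka.
  rewrite (@act_eq _ _ N a f (value (mk_node a f))); last first.
    by move=> k ka; rewrite value_mk ka.
  apply: (ciso_act gR) => //; apply: xor_group_finite_support => //.
    apply: sub_finite_set fin => k /=; rewrite value_mk => /andP[ka fk]; split=> //.
    by rewrite leNgt; apply/negP => /(mk_node_inj f0); rewrite fk.
  by move=> k; rewrite value_mk => /andP[ka _]; exact: G1 ka.
have nRac f x y' : G f -> R x y' -> x <> act a f c.
  move=> Gf Rxy xE; apply: (nRc (act a f y')).
  by rewrite -[c](actK a f c tM) -xE; exact: (ciso_act gR).
have nRae f x y' : G f -> R x y' -> y' <> act a f e.
  move=> Gf Rxy xE; apply: (nRe (act a f x)).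
  by rewrite -[e](actK a f e tN) -xE; exact: (ciso_act gR).
have lvlc f : lvl a (act a f c) by exact: (lvl_act tM).
have lvle f : lvl a (act a f e) by exact: (lvl_act tN).
exists (fun x y => R x y \/ exists2 f, G f & x = act a f c /\ y = act a f e), e; split.
- case: gR => Req Rlvl Rproj Ract Rbot Rdom Rran; split.
  + move=> x x' z z' [Rxz|[f Gf [-> ->]]] [Rxz'|[f' Gf' [-> ->]]].
    * exact: Req.
    * by split=> E; subst; [case: (nRac _ _ _ Gf' Rxz)|case: (nRae _ _ _ Gf' Rxz)].
    * by split=> E; subst; [case: (nRac _ _ _ Gf Rxz')|case: (nRae _ _ _ Gf Rxz')].
    * by split=> [/(act_free tM ca)|/(act_free tN ea)]; rewrite /act => ->.
  + move=> a' x z Sa' [Rxz|[f Gf [-> ->]]]; first exact: Rlvl.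
    split=> [/(lvl_inj tM (lvlc f)) <-//|/(lvl_inj tN (lvle f)) <-//].
  + move=> a' b' h' x z Sa' Sb' [Rxz|[f Gf [-> ->]]]; first by left; exact: Rproj.
    have [aE|na] := eqVneq a' a; last first.
      right; exists f => //; rewrite !proj_out // => h1; case/eqP: na.
        exact: (lvl_inj tN h1 (lvle f)).
      exact: (lvl_inj tM h1 (lvlc f)).
    subst a'; have [bE|nb] := eqVneq b' a.
      by subst b'; right; exists f => //; rewrite !proj_id.
    left; rewrite !proj_act //; apply: Ract => //.
    have b'b : (b' <= b)%O by apply: pred_b => //; rewrite lt_neqAle nb.
    by rewrite -(proj_comp tM h b'b h') // -(proj_comp tN h b'b h') // ey; exact: Rproj.
  + move=> a' g x z Sa' Gg [Rxz|[f Gf [-> ->]]]; first by left; exact: Ract.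
    right; have [aE|na] := eqVneq a' a; last first.
      exists f => //; rewrite (@act_out _ _ M a' g) // ?(@act_out _ _ N a' g) // => h1; case/eqP: na.
        exact: (lvl_inj tN h1 (lvle f)).
      exact: (lvl_inj tM h1 (lvlc f)).
    by subst a'; exists (fun k => g k (+) f k); [exact: GD|rewrite !actD].
  + by move=> x z xo zo; left; exact: Rbot.
  + apply: sub_countable (countableU Rdom (countable_image (fun f => act a f c) countG)).
    apply: subset_card_le => x [z [Rxz|[f Gf [-> _]]]]; [left; exists z|right; exists f] => //.
  + apply: sub_countable (countableU Rran (countable_image (fun f => act a f e) countG)).
    apply: subset_card_le => x [z [Rxz|[f Gf [_ ->]]]]; [left; exists z|right; exists f] => //.
- by right; exists (fun=> false) => //; rewrite !act0.
- by left.
Qed.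

(** Climb through the named levels up to [a]; the minimal level at which this fails has a
    predecessor, unless it is the bottom one. *)
Lemma extend_named a : S a -> forall (R : M -> N -> Prop) c, countable_iso R -> lvl a c ->
  exists (R' : M -> N -> Prop) y, [/\ countable_iso R', R' c y & forall u v, R u v -> R' u v].
Proof.
move=> Sa; apply: contrapT => nota.
have /(omega1_min hW)[{Sa nota} b [Sb +] bmin] : exists b, S b /\
    ~ (forall (R : M -> N -> Prop) c, countable_iso R -> lvl b c ->
       exists (R' : M -> N -> Prop) y, [/\ countable_iso R', R' c y & forall u v, R u v -> R' u v]).
  by exists a.
apply=> R c gR cb.
have [bo|nbo] := eqVneq b o.
  subst b; have [y yo] := lvl_inhab tN o; exists R, y; split=> //.
  exact: (ciso_bottom gR).
have [p [Sp pb] pmax] : exists2 p, S p /\ (p < b)%O & forall e, S e /\ (e < b)%O -> (e <= p)%O.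
  apply: (@finite_maximum _ _ [set p | S p /\ (p < b)%O]).
    by apply: sub_finite_set finS => p [].
  by exists o; split=> //; rewrite lt_neqAle eq_sym nbo o_min.
have hpb := ltW pb.
have [R1 [y [gR1 Ry RR1]]] : exists (R' : M -> N -> Prop) y,
    [/\ countable_iso R', R' (proj hpb c) y & forall u v, R u v -> R' u v].
  apply: contrapT => no; have := bmin p; rewrite leNgt pb; move=> /(_ _)/negP; apply=> //.
  by split=> // /(_ R (proj hpb c) gR (lvl_proj tM hpb cb)).
have [||R2 [z [gR2 Rz RR2]]] := extend_next gR1 Sb Sp _ _ cb Ry.
- by rewrite (lt_eqF pb).
- by move=> e Se eb; apply: pmax.
by exists R2, z; split=> // u v /RR1/RR2.
Qed.

Lemma ciso_forth (R : M -> N -> Prop) c : countable_iso R ->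
  exists (R' : M -> N -> Prop) y, [/\ countable_iso R', R' c y & forall u v, R u v -> R' u v].
Proof.
move=> gR; have [[a [Sa ca]]|/forallNP Sc] := pselect (exists a, S a /\ lvl a c).
  exact: extend_named gR ca.
have [[y Rcy]|/forallNP nRc] := pselect (exists y, R c y); first by exists R, y.
by apply: extend_unnamed => // a Sa ca; apply: (Sc a).
Qed.

End Extension.

Section Equivalence.
Context {d : Order.disp_t} (W : orderType d) (hW : is_omega1 W).
Local Notation L := (tree_language W).

Definition named_levels (s : symbols L) : set W :=
  match s with
  | inl (Proj a b _) => [set a; b]
  | inl (Shift e) => [set lg e]
  | inr (U a) => [set a]
  end.

Definition named_shift (s : symbols L) : W -> bool :=
  match s with
  | inl (Shift e) => value e
  | _ => fun=> false
  end.

(** The levels and the group of shifts depend on the formula: no single family of partial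
    isomorphisms serves all of them, because with all shifts named a level of the tree is one
    orbit, while another structure may have several. *)
Theorem tree_like_elem_equiv (M N : structure L) :
  tree_like M -> tree_like N -> elem_equiv M N.
Proof.
move=> tM tN; have [o o_min] := omega1_bottom hW.
suff E n (phi : formula L n) : exists R : M -> N -> Prop,
    forall a b, (forall i, R (a i) (b i)) -> sat phi a <-> sat phi b.
  apply/seteqP; split=> phi /= sphi v; have [R /= RE] := E 0 phi.
    by apply/(RE (fun i => False_rect _ (notF (ltn_ord i)))); [case|].
  by apply/(RE _ (fun i => False_rect _ (notF (ltn_ord i)))); [case|].
pose P := form_syms phi; have finP : finite_set P by exact: finite_form_syms.
pose S := [set o] `|` \bigcup_(s in P) named_levels s.
have finS : finite_set S.
  rewrite finite_setU; split; first exact: finite_set1.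
  apply: bigcup_finite => // -[[a b h|e]|[a]] _; [exact: finite_set2| |]; exact: finite_set1.
have So : S o by left.
have PS s a : P s -> named_levels s a -> S a by move=> Ps sa; right; exists s.
have [m Sm] := omega1_bounded hW (finite_set_countable finS).
(* The group of shifts is generated by those of the formula and by the single coordinates
   below the named levels. *)
have [|G [cG AG G0 GD]] :=
    @countable_xor_group _ ((named_shift @` P) `|` ((fun c : W => pred1 c : W -> bool) @` [set c | (c < m)%O])).
  apply: countableU; first by apply: countable_image; exact: finite_set_countable.
  by apply: countable_image; case: hW.
have G1 a c : S a -> (c < a)%O -> G (pred1 c).
  by move=> /Sm am ca; apply: AG; right; exists c => //=; exact: lt_trans am.
pose RR : set (M -> N -> Prop) := [set R | countable_iso o S G R].
exists (fun x y => lvl o x /\ lvl o y) => a b Rab.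
apply: (@back_and_forth _ M N P RR) Rab => //.
- move=> R gR; split; first exact: (ciso_eq gR).
  + move=> [a' b' h|e] v w Ps /(_ ord0) vw; rewrite (vec1 v) (vec1 w).
      by apply: (ciso_proj gR h) => //; apply: (PS _ _ Ps); [left|right].
    rewrite -[e]mk_nodeK; apply: (ciso_act gR) => //; first by apply: (PS _ _ Ps).
    by apply: AG; left; exists (inl (Shift e : Defs.fsym L)).
  + move=> [a'] v w Ps /(_ ord0) vw; rewrite (vec1 v) (vec1 w).
    by apply: (ciso_lvl gR) => //; apply: (PS _ _ Ps).
- by move=> R x; exact: ciso_forth.
- move=> R y /ciso_sym /(ciso_forth hW o_min finS So cG G0 GD G1 tN tM y)[R' [x [gR' R'yx RR']]].
  by exists (fun x y => R' y x), x; split=> //; [exact: ciso_sym | move=> u v /RR'].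
- exact: ciso_start.
Qed.

End Equivalence.

(** * The tree and a tree-like structure without branches *)

Section StandardModel.
Context {d : Order.disp_t} (W : orderType d).
Local Notation L := (tree_language W).

Lemma act_tree a f (x : tree W) : lg x = a ->
  act a f x = mk_node a (fun c => f c (+) value x c).
Proof.
move=> xa; rewrite /act /shift /= xa eqxx /add_node xa.
by apply: mk_node_eq => c ca; rewrite value_mk ca.
Qed.

Lemma proj_tree a b (h : (b <= a)%O) (x : tree W) : lg x = a ->
  proj h x = mk_node b (value x).
Proof. by move=> xa; rewrite /proj /= xa eqxx. Qed.

Lemma tree_is_tree_like : tree_like (tree W).
Proof.
have lvlE a (x : tree W) : lvl a x = (lg x = a) by [].
split.
- by move=> x a b <-.
- by move=> a; exists (mk_node a (fun=> false)).
- by move=> a b h x /eqP/negPf xa; rewrite /proj /= xa.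
- by move=> a b h x xa; rewrite proj_tree.
- by move=> a h x xa; rewrite proj_tree // -xa mk_nodeK.
- move=> a b c hab hbc hac x xa; rewrite !proj_tree //; apply: mk_node_eq => k kc.
  by rewrite value_mk (lt_le_trans kc hbc).
- move=> a b h y yb; exists (mk_node a (value y)) => //.
  rewrite proj_tree // -[RHS]mk_nodeK yb; apply: mk_node_eq => c cb.
  by rewrite value_mk (lt_le_trans cb h).
- by move=> e x /eqP/negPf xe; rewrite /shift /= xe.
- by move=> a f x xa; rewrite act_tree.
- by move=> a x xa; rewrite act_tree // -[RHS]mk_nodeK xa; exact: mk_node_eq.
- move=> a f g x xa; rewrite !act_tree //; apply: mk_node_eq => c ca.
  by rewrite value_mk ca addbA.
- move=> a f g x xa; rewrite !act_tree // => /mk_node_inj fg; apply: mk_node_eq => c.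
  by move=> /fg; exact: addIb.
- move=> a b h f x xa; rewrite !(act_tree, proj_tree) //; apply: mk_node_eq => c cb.
  by rewrite !value_mk cb (lt_le_trans cb h).
- move=> a b h x y _ xa ya _; exists (fun c => value x c (+) value y c).
  rewrite act_tree // -[LHS]mk_nodeK ya; apply: mk_node_eq => c _.
  by rewrite addbAC addbb.
- move=> b x y bmin xb yb; apply: node_ext => [|c]; first by rewrite xb yb.
  by rewrite xb ltNge bmin.
Qed.

End StandardModel.

Section TwistedModel.
Context {d : Order.disp_t} (W : orderType d) (hW : is_omega1 W).
Local Notation L := (tree_language W).

(** The [g] with [g + omega <= a]. This set is the same for [a] and for its successor. *)
Definition far_below (a : W) : set W :=
  [set g | infinite_set [set c : W | (g <= c)%O /\ (c < a)%O]].

(** Finite-to-one functions on [far_below a], extended by zero so that equality of threads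
    is equality of functions. *)
Definition thread (a : W) (t : W -> nat) : Prop :=
  (forall g, ~ far_below a g -> t g = 0) /\
  forall n, finite_set [set g | far_below a g /\ t g = n].

Definition cut (b : W) (t : W -> nat) (g : W) : nat :=
  if `[< far_below b g >] then t g else 0.

Lemma far_below_le a b g : (b <= a)%O -> far_below b g -> far_below a g.
Proof.
move=> ba; apply: sub_infinite_set => c [gc cb]; split=> //; exact: lt_le_trans ba.
Qed.

Lemma far_below_gap a b g : finite_set [set c : W | (b <= c)%O /\ (c < a)%O] ->
  far_below a g -> far_below b g.
Proof.
move=> fin ag bg; apply: ag.
apply: (@sub_finite_set _ _ ([set c : W | (g <= c)%O /\ (c < b)%O] `|`
                             [set c : W | (b <= c)%O /\ (c < a)%O])); last first.
  by rewrite finite_setU.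
by move=> c [gc ca]; case: (ltP c b) => [cb|bc]; [left|right].
Qed.

Lemma thread_cut a b t : (b <= a)%O -> thread a t -> thread b (cut b t).
Proof.
move=> ba [t0 tfin]; split=> [g bg|n]; first by rewrite /cut asboolF.
apply: sub_finite_set (tfin n) => g [bg]; rewrite /cut asboolT // => tg.
by split=> //; exact: far_below_le bg.
Qed.

(** Use an injection of the countable set [{c | c < a}] into the natural numbers on the
    new points: it adds at most one point to each fiber. *)
Lemma thread_extend a b t : (b <= a)%O -> thread b t ->
  exists2 t', thread a t' & cut b t' = t.
Proof.
case: hW => _ /(_ a)/countable_injP[k kinj] _ ba [t0 tfin].
exists (fun g => if `[< far_below b g >] then t g else
                 if `[< far_below a g >] then k g else 0).
  split=> [g ag|n].
    by rewrite [in X in if X then t g else _]asboolF ?asboolF // => /(far_below_le ba).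
  apply: (@sub_finite_set _ _ ([set g | far_below b g /\ t g = n] `|`
                               [set g : W | (g < a)%O /\ k g = n])).
    move=> g [ag]; case: asboolP => [bg tg|bg]; first by left.
    rewrite asboolT // => kg; right; split=> //.
    by have [c [gc ca]] := infinite_setN0 ag; exact: le_lt_trans ca.
  rewrite finite_setU; split=> //.
  have [[g [ga kg]]|no] := pselect (exists g, (g < a)%O /\ k g = n); last first.
    by apply: sub_finite_set (finite_set0 W) => g gP; case: no; exists g.
  apply: sub_finite_set (finite_set1 g) => g' [ga' kg'].
  by apply: kinj; rewrite ?inE // kg.
apply/funext => g; rewrite /cut; case: asboolP => // bg; by rewrite t0.
Qed.

Definition pair_fun (s : tree_fsym W) (p : node W * (W -> nat)) : node W * (W -> nat) :=
  (tree_fun s p.1,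
   if s is Proj a b _ then if lg p.1 == a then cut b p.2 else p.2 else p.2).

Lemma pair_fun_thread s p :
  thread (lg p.1) p.2 -> thread (lg (pair_fun s p).1) (pair_fun s p).2.
Proof.
case: s => [a b h|e] /=; last by case: eqP.
by case: eqP => // pa pt; apply: (thread_cut h); rewrite -pa.
Qed.

Definition twisted : structure L :=
  @Structure L {p : node W * (W -> nat) | thread (lg p.1) p.2}
    (fun s x => exist _ (pair_fun s (sval (x ord0))) (pair_fun_thread s (svalP (x ord0))))
    (fun r x => tree_rel r (sval (x ord0)).1).

Lemma twisted_ext (p q : twisted) :
  (sval p).1 = (sval q).1 :> node W -> (sval p).2 = (sval q).2 -> p = q.
Proof.
case: p q => [[x t] pt] [[y u] qu] /= xy tu; subst y u.
by congr exist; exact: Prop_irrelevance.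
Qed.

Lemma twisted_is_tree_like : tree_like twisted.
Proof.
have tT := tree_is_tree_like W.
have lvlE a (p : twisted) : lvl a p = @lvl _ W (tree W) a (sval p).1 by [].
have proj2 a b (h : (b <= a)%O) (p : twisted) : lvl a p ->
    (sval (proj h p)).2 = cut b (sval p).2.
  by rewrite lvlE => pa; rewrite /proj /= pa eqxx.
have thread0 a : exists t, thread a t.
  have [o o_min] := omega1_bottom hW.
  have [|t ta _] := @thread_extend a o (fun=> 0) (o_min a); last by exists t.
  split=> // n; apply: sub_finite_set (finite_set0 W) => g [go _] /=; apply: go.
  by apply: sub_finite_set (finite_set0 W) => c [_]; rewrite ltNge o_min.
split.
- by move=> x a b; rewrite !lvlE; exact: lvl_inj.
- move=> a; have [t ta] := thread0 a.
  by exists (exist _ (mk_node a (fun=> false), t) ta).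
- move=> a b h p; rewrite lvlE => pa; apply: twisted_ext => /=.
    exact: (proj_out tT).
  by move/eqP/negPf: pa => ->.
- by move=> a b h p; rewrite !lvlE; exact: (lvl_proj tT).
- move=> a h p pa; apply: twisted_ext; first exact: (proj_id tT).
  rewrite proj2 //; case: p pa => [[x t] /= [t0 tfin]] xa.
  apply/funext => g; rewrite /cut; case: asboolP => // ag; rewrite t0 //.
  by have -> : lg x = a.
- move=> a b c hab hbc hac p pa; have := pa; rewrite lvlE => pa1.
  have pb : lvl b (proj hab p) by rewrite lvlE; exact: (lvl_proj tT hab).
  apply: twisted_ext; first exact: (proj_comp tT hab hbc hac).
  rewrite !proj2 //; apply/funext => g; rewrite /cut; case: asboolP => // cg.
  by rewrite asboolT //; exact: far_below_le cg.
- move=> a b h [[y u] /= yu] yb; have {}yb : lg y = b by [].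
  have [x xa xy] := proj_surj tT h yb.
  have ub : thread b u by rewrite -yb.
  have [t ta tu] := thread_extend h ub.
  have xt : thread (lg (x, t).1) (x, t).2 by rewrite [lg _]xa.
  exists (exist _ (x, t) xt) => //.
  by apply: twisted_ext => //; rewrite proj2.
- by move=> e p; rewrite lvlE => pe; apply: twisted_ext => //; exact: (shift_out tT).
- by move=> a f p; rewrite !lvlE; exact: (lvl_act tT).
- by move=> a p; rewrite lvlE => pa; apply: twisted_ext => //; exact: (act0 tT).
- by move=> a f g p; rewrite lvlE => pa; apply: twisted_ext => //; exact: (actD tT).
- move=> a f g p; rewrite lvlE => pa /(congr1 (fun q : twisted => (sval q).1)).
  exact: (act_free tT).
- move=> a b h f p pa; apply: twisted_ext; first exact: (proj_act tT).
  have pa' : lvl a (act a f p) by rewrite lvlE; exact: (lvl_act tT).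
  by rewrite (proj2 _ _ h _ pa'); exact/esym/proj2.
- move=> a b h p q fin pa qa pq.
  have [|f fE] := @finite_gap _ _ _ tT a b h (sval p).1 (sval q).1 fin pa qa.
    exact: (congr1 (fun r : twisted => (sval r).1) pq).
  exists f; apply: twisted_ext => //=.
  have := congr1 (fun q : twisted => (sval q).2) pq; rewrite !proj2 // => cutpq.
  apply/funext => g; have [bg|bg] := pselect (far_below b g).
    by have := congr1 (fun t => t g) cutpq; rewrite /cut asboolT.
  have ag : ~ far_below a g by move=> /(far_below_gap fin).
  have z (r : twisted) : lvl a r -> (sval r).2 g = 0.
    by case: r => [[x t] /= [t0 _]] xa; apply: t0; have -> : lg x = a.
  by rewrite z // z.
- move=> o p q o_min po qo; apply: twisted_ext; first exact: (lvl_bottom tT o_min).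
  have z (r : twisted) : lvl o r -> (sval r).2 = (fun=> 0).
    case: r => [[x t] /= [t0 _]] xo; apply/funext => g; apply: t0; have -> : lg x = o by []; apply.
    by apply: sub_finite_set (finite_set0 W) => c [_]; rewrite ltNge o_min.
  by rewrite z // z.
Qed.

(** The threads of a branch agree where they are both defined, so they glue to one function on
    [omega_1]. Each of its fibers is finite, since an infinite set has an infinite bounded
    part, on which the fiber is that of a single thread. *)
Lemma twisted_no_branch (c : W -> twisted) : (forall a, lvl a (c a)) ->
  ~ (forall a b (h : (b <= a)%O), proj h (c a) = c b).
Proof.
move=> ca cproj; pose t a := (sval (c a)).2.
have tcut a b : (b <= a)%O -> t b = cut b (t a).
  move=> h; rewrite /t -(cproj a b h) /proj /=.
  by have := ca a; rewrite /lvl /= => ->; rewrite eqxx.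
have tE a b g : far_below a g -> far_below b g -> t a g = t b g.
  wlog ba : a b / (b <= a)%O => [H ag bg|ag bg].
    by case: (leP b a) => [|/ltW] ab; [exact: H|rewrite (H b a)].
  by rewrite (tcut a b ba) /cut asboolT.
have tfin a n : finite_set [set g | far_below a g /\ t a g = n].
  by rewrite /t; have := svalP (c a); have := ca a; rewrite {1}/lvl /= => -> [_ /(_ n)].
have /choice[f far_f] : forall g, exists a, far_below a g.
  move=> g.
  have gt_inf : infinite_set [set c : W | (g <= c)%O].
    move=> /finite_set_countable cg; case: hW => _ seg; apply.
    apply: sub_countable (countableU (seg g) cg); apply: subset_card_le => x _ /=.
    by case: (ltP x g) => xg; [left|right].
  by have [a] := infinite_set_bounded hW gt_inf; exists a.
have fiber_fin n : finite_set [set g | t (f g) g = n].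
  apply: contrapT => /(infinite_set_bounded hW)[a]; apply.
  apply: sub_finite_set (tfin (f a) n) => g [/= tg ga].
  have ag : far_below (f a) g.
    by apply: sub_infinite_set (far_f a) => x [ax xf]; split=> //; exact: le_trans (ltW ga) ax.
  by split=> //; rewrite -tg; exact: tE.
case: hW => _ _; apply.
apply: (@sub_countable _ _ _ (\bigcup_n [set g | t (f g) g = n])).
  by apply: subset_card_le => g _; exists (t (f g) g).
by apply: bigcup_countable => // n _; exact: finite_set_countable.
Qed.

(** The images of the zero sequences form a branch. *)
Theorem tree_not_prime : ~ prime_structure (tree W).
Proof.
have eqT := tree_like_elem_equiv hW twisted_is_tree_like (tree_is_tree_like W).
move=> /(_ twisted eqT)[f femb].
pose x a : tree W := mk_node a (fun=> false).
apply: (@twisted_no_branch (fun a => f (x a))) => [a|a b h].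
  have := femb 1 (@Rel L 1 (U a) (fun=> Var L ord0)) (fun=> x a).
  by move=> /= [+ _]; apply.
have := femb 2 (Equal (@App L 2 (Proj h) (fun=> Var L ord0)) (Var L ord_max))
  (fun i => if i == ord0 then x a else x b).
move=> [+ _]; apply; rewrite /= !eqxx.
apply: mk_node_eq => c cb; by rewrite value_mk andbF.
Qed.

End TwistedModel.

(** * The tree is atomic *)

Section Atomic.
Context {d : Order.disp_t} (W : orderType d).
Local Notation L := (tree_language W).

Definition translate (xi : W -> bool) (x : tree W) : tree W :=
  mk_node (lg x) (fun c => xi c (+) value x c).

Lemma translate_isomorphism xi : isomorphism (translate xi).
Proof.
have K : involutive (translate xi).
  move=> x; rewrite /translate -[RHS]mk_nodeK; apply: mk_node_eq => c cx.
  by rewrite value_mk cx addKb.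
split; first exact: inv_bij K.
- move=> [a b h|e] v /=; set x : tree W := v ord0; rewrite -/x.
    case: eqP => // xa; apply: mk_node_eq => c cb.
    by rewrite !value_mk cb xa (lt_le_trans cb h).
  rewrite /translate /add_node /=; case: eqP => // xe; apply: mk_node_eq => c cx.
  by rewrite !value_mk cx addbCA.
- by move=> [a] v.
Qed.

(** The isolating formula says that the longest entry [a j] has its length and that every
    entry is a named shift of a projection of it. Two solutions differ by a translation. *)
Lemma tree_atomic : atomic (tree W).
Proof.
move=> [|n] a.
  exists (neg (Bot L 0)) => // psi /= psia; apply: entails_Th => b _.
  by suff -> : b = a by []; apply/funext; case.
have [_ [j _ <-] jmax] : exists2 m, range (fun i => lg (a i)) m &
    forall x, range (fun i => lg (a i)) x -> (x <= m)%O.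
  apply: finite_maximum; first exact/finite_image/finite_finset.
  by exists (lg (a ord0)), ord0.
have {}jmax i : (lg (a i) <= lg (a j))%O by apply: jmax; exists i.
pose e i : node W := mk_node (lg (a i)) (fun c => value (a i) c (+) value (a j) c).
pose phi : formula L n.+1 := conj (@Rel L n.+1 (U (lg (a j))) (fun=> Var L j))
  (conj_ord (fun i => Equal (Var L i)
     (@App L n.+1 (Shift (e i)) (fun=> @App L n.+1 (Proj (jmax i)) (fun=> Var L j))))).
have phiE (v : 'I_n.+1 -> tree W) : sat phi v <-> lg (v j) = lg (a j) /\
    forall i, v i = shift (e i) (proj (jmax i) (v j)).
  by rewrite sat_conj sat_conj_ord.
have phia : sat phi a.
  apply/phiE; split=> // i; rewrite -/(act _ _ _) proj_tree // act_tree //.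
  rewrite -[LHS]mk_nodeK; apply: mk_node_eq => c ci.
  by rewrite value_mk ci -addbA addbb addbF.
exists phi => // psi psia; apply: entails_Th => v /phiE[vj vi].
have [_ ai] := (phiE a).1 phia.
pose xi c := value (a j) c (+) value (v j) c.
have [_ tfun _] := translate_isomorphism xi.
have tj : translate xi (a j) = v j.
  rewrite /translate -[RHS]mk_nodeK vj; apply: mk_node_eq => c _.
  by rewrite /xi addbAC addbb.
have -> : v = translate xi \o a.
  apply/funext => i /=; rewrite vi -tj.
  apply: etrans (congr1 (translate xi) (esym (ai i))).
  have -> (y : tree W) : translate xi (shift (e i) y) = shift (e i) (translate xi y).
    exact: tfun (Shift (e i)) (fun=> y).
  by congr shift; exact: esym (tfun (Proj (jmax i)) (fun=> a j)).
by have [tpsi _] := isomorphism_sat (translate_isomorphism xi) psi a; exact: tpsi.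
Qed.

End Atomic.

(** * Uniqueness of the atomic model *)

Section Uniqueness.
Context {d : Order.disp_t} (W : orderType d).
Local Notation L := (tree_language W).

Section AtomicTreeLike.
Context (N : structure L) (NT : models N (Th (tree W))) (atN : atomic N).

(** An element of the level [a] is not generated by given elements, so its existence has to
    transfer as a sentence of the theory. *)
Lemma level_inhabited a : exists y : N, lvl a y.
Proof.
have TN : models (tree W) (Th N) by rewrite /models (Th_complete NT).
have [|v] := @sat_realized L N (tree W) 1 (@Rel L 1 (U a) (fun=> Var L ord0))
  (fun=> mk_node a (fun=> false)) TN; first by [].
by exists (v ord0).
Qed.

Lemma pair_transfer (y y' : N) : exists (x x' : tree W) (R : tree W -> N -> Prop),
  [/\ R x y /\ R x' y',
      (forall u u' v v', R u v -> R u' v' -> u = u' <-> v = v'),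
      (forall a u v, R u v -> lvl a u <-> lvl a v),
      (forall a b (h : (b <= a)%O) u v, R u v -> R (proj h u) (proj h v))
    & (forall e u v, R u v -> R (shift e u) (shift e v))].
Proof.
have [a [R [pR Rab]]] := atomic_partial_iso (fun i : 'I_2 => if i == ord0 then y else y') NT atN.
exists (a ord0), (a ord_max), R; split.
- by split; [exact: (Rab ord0)|exact: (Rab ord_max)].
- exact: (piso_eq pR).
- by move=> c u v Ruv; apply: (piso_rel pR).
- by move=> c b h u v Ruv; apply: (piso_fun pR).
- by move=> e u v Ruv; apply: (piso_fun pR).
Qed.

Lemma atomic_level (y : N) : exists a, lvl a y.
Proof.
have [x [_ [R [[Rx _] _ Rlvl _ _]]]] := pair_transfer y y.
by exists (lg x); apply/(Rlvl _ _ _ Rx).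
Qed.

(** That some named shift takes [y] to [y'] is an infinite disjunction, which is not
    preserved by elementary equivalence; atomicity makes it hold. *)
Lemma atomic_transitive a (y y' : N) : lvl a y -> lvl a y' -> exists f, y' = act a f y.
Proof.
have [x [x' [R [[Rx Rx'] Req Rlvl Rproj Rsh]]]] := pair_transfer y y'.
move=> /(Rlvl _ _ _ Rx) xa /(Rlvl _ _ _ Rx') xa'.
exists (fun c => value x c (+) value x' c).
apply/(Req _ _ _ _ Rx' (Rsh _ _ _ Rx)).
rewrite -/(act _ _ _) act_tree // -[LHS]mk_nodeK [lg _]xa'; apply: mk_node_eq => c _.
by rewrite addbAC addbb.
Qed.

Lemma atomic_tree_like : tree_like N.
Proof.
have tT := tree_is_tree_like W.
split.
- move=> y a b; have [x [_ [R [[Rx _] Req Rlvl Rproj Rsh]]]] := pair_transfer y y.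
  by move=> /(Rlvl _ _ _ Rx) + /(Rlvl _ _ _ Rx); exact: lvl_inj.
- exact: level_inhabited.
- move=> a b h y; have [x [_ [R [[Rx _] Req Rlvl Rproj Rsh]]]] := pair_transfer y y.
  rewrite -(Rlvl _ _ _ Rx) => xa; apply/(Req _ _ _ _ (Rproj _ _ h _ _ Rx) Rx).
  exact: proj_out.
- move=> a b h y; have [x [_ [R [[Rx _] Req Rlvl Rproj Rsh]]]] := pair_transfer y y.
  rewrite -(Rlvl _ _ _ Rx) => xa; apply/(Rlvl _ _ _ (Rproj _ _ h _ _ Rx)).
  exact: lvl_proj.
- move=> a h y; have [x [_ [R [[Rx _] Req Rlvl Rproj Rsh]]]] := pair_transfer y y.
  rewrite -(Rlvl _ _ _ Rx) => xa; apply/(Req _ _ _ _ (Rproj _ _ h _ _ Rx) Rx).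
  exact: proj_id.
- move=> a b c hab hbc hac y.
  have [x [_ [R [[Rx _] Req Rlvl Rproj Rsh]]]] := pair_transfer y y.
  rewrite -(Rlvl _ _ _ Rx) => xa.
  apply/(Req _ _ _ _ (Rproj _ _ _ _ _ (Rproj _ _ _ _ _ Rx)) (Rproj _ _ _ _ _ Rx)).
  exact: proj_comp.
- move=> a b h y yb; have [z za] := level_inhabited a.
  have [x [x' [R [[Rx Rx'] Req Rlvl Rproj Rsh]]]] := pair_transfer z y.
  have xa : lvl a x by apply/(Rlvl _ _ _ Rx).
  have xb : lvl b x' by apply/(Rlvl _ _ _ Rx').
  have zb : lvl b (proj h z).
    by apply/(Rlvl _ _ _ (Rproj _ _ h _ _ Rx)); exact: lvl_proj.
  have [f yE] := atomic_transitive zb yb.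
  have Rf := Rsh (mk_node a f) _ _ Rx; rewrite -!/(act _ _ _) in Rf.
  exists (act a f z); first by apply/(Rlvl _ _ _ Rf); exact: lvl_act.
  rewrite yE.
  have Rp := Rsh (mk_node b f) _ _ (Rproj _ _ h _ _ Rx); rewrite -!/(act _ _ _) in Rp.
  by apply/(Req _ _ _ _ (Rproj _ _ h _ _ Rf) Rp); exact: proj_act.
- move=> e y; have [x [_ [R [[Rx _] Req Rlvl Rproj Rsh]]]] := pair_transfer y y.
  rewrite -(Rlvl _ _ _ Rx) => xe; apply/(Req _ _ _ _ (Rsh e _ _ Rx) Rx).
  exact: shift_out.
- move=> a f y; have [x [_ [R [[Rx _] Req Rlvl Rproj Rsh]]]] := pair_transfer y y.
  rewrite -(Rlvl _ _ _ Rx) => xa; apply/(Rlvl _ _ _ (Rsh (mk_node a f) _ _ Rx)).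
  exact: (lvl_act tT f).
- move=> a y; have [x [_ [R [[Rx _] Req Rlvl Rproj Rsh]]]] := pair_transfer y y.
  rewrite -(Rlvl _ _ _ Rx) => xa; apply/(Req _ _ _ _ (Rsh (mk_node a _) _ _ Rx) Rx).
  exact: (act0 tT xa).
- move=> a f g y; have [x [_ [R [[Rx _] Req Rlvl Rproj Rsh]]]] := pair_transfer y y.
  rewrite -(Rlvl _ _ _ Rx) => xa.
  apply/(Req _ _ _ _ (Rsh (mk_node a f) _ _ (Rsh (mk_node a g) _ _ Rx))
                      (Rsh (mk_node a _) _ _ Rx)).
  exact: (actD tT f g xa).
- move=> a f g y; have [x [_ [R [[Rx _] Req Rlvl Rproj Rsh]]]] := pair_transfer y y.
  rewrite -(Rlvl _ _ _ Rx) => xa.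
  move=> /(Req _ _ _ _ (Rsh (mk_node a f) _ _ Rx) (Rsh (mk_node a g) _ _ Rx)).
  exact: (act_free tT xa).
- move=> a b h f y; have [x [_ [R [[Rx _] Req Rlvl Rproj Rsh]]]] := pair_transfer y y.
  rewrite -(Rlvl _ _ _ Rx) => xa.
  apply/(Req _ _ _ _ (Rproj _ _ h _ _ (Rsh (mk_node a f) _ _ Rx))
                      (Rsh (mk_node b f) _ _ (Rproj _ _ h _ _ Rx))).
  exact: (proj_act tT h f xa).
- by move=> a b h y y' _ ya ya' _; exact: atomic_transitive.
- move=> o y y' o_min; have [x [x' [R [[Rx Rx'] Req Rlvl Rproj Rsh]]]] := pair_transfer y y'.
  move=> /(Rlvl _ _ _ Rx) xo /(Rlvl _ _ _ Rx') xo'.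
  by apply/(Req _ _ _ _ Rx Rx'); apply: (lvl_bottom tT o_min).
Qed.

End AtomicTreeLike.

Section Coordinates.
Context (hW : is_omega1 W) (N : structure L) (tN : tree_like N).
Context (levels : forall y : N, exists a, lvl a y).
Context (transitive_levels : forall a (y y' : N), lvl a y -> lvl a y' ->
  exists f, y' = act a f y).

(** The correction [xi] only uses the coordinate [g] of the cocycle from [a] to [g + 1], the
    least level at which this coordinate is visible; the cocycle identity at [g] then says that
    the corrected origins agree. *)
Lemma coherent_branch : exists c : W -> N, (forall a, lvl a (c a)) /\
  forall a b (h : (b <= a)%O), proj h (c a) = c b.
Proof.
have /choice[e ea] := lvl_inhab tN.
have /choice[eta etaP] (ab : W * W) : exists f, forall h : (ab.2 <= ab.1)%O,
    proj h (e ab.1) = act ab.2 f (e ab.2).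
  case: ab => a b /=; have [h|nh] := pselect (is_true (b <= a)%O); last by exists (fun=> false).
  have [f fE] := transitive_levels (ea b) (lvl_proj tN h (ea a)).
  by exists f => h'; have -> : h' = h by exact: bool_irrelevance.
have {}etaP a b (h : (b <= a)%O) : proj h (e a) = act b (eta (a, b)) (e b).
  exact: (etaP (a, b)).
have /choice[s sP] (g : W) : exists b, (g < b)%O /\ forall c, (g < c)%O -> (b <= c)%O.
  by have [b] := omega1_succ hW g; exists b.
have cocycle a b g : (b <= a)%O -> (g < b)%O ->
    eta (a, s g) g = eta (a, b) g (+) eta (b, s g) g.
  move=> ba gb; have [gs /(_ _ gb) sb] := sP g; have sa := le_trans sb ba.
  suff : mk_node (s g) (eta (a, s g)) =
      mk_node (s g) (fun c => eta (a, b) c (+) eta (b, s g) c) by move/mk_node_inj; apply.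
  apply: (act_free tN (ea (s g))).
  rewrite -(etaP _ _ sa) -(actD tN) // -(etaP _ _ sb) -(proj_act tN) //.
  by rewrite -(etaP _ _ ba) (proj_comp tN ba sb sa).
pose xi a g := eta (a, s g) g.
exists (fun a => act a (xi a) (e a)); split=> [a|a b h]; first exact: (lvl_act tN).
rewrite (proj_act tN) // etaP (actD tN) //; apply: act_eq => g gb.
by rewrite /xi (cocycle a b g h gb) addbAC addbb.
Qed.

(** Once an origin has been chosen coherently, a point is the node that moves the origin of its
    level to it. *)
Lemma tree_like_transitive_isomorphic : isomorphic N (tree W).
Proof.
have [c [ca cproj]] := coherent_branch.
pose F (x : tree W) : N := act (lg x) (value x) (c (lg x)).
have Flvl x : lvl (lg x) (F x) by exact: (lvl_act tN).
have Fmk a f : F (mk_node a f) = act a f (c a).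
  by apply: act_eq => k ka; rewrite value_mk ka.
have Finj x x' : F x = F x' -> x = x'.
  move=> FE; have lE : lg x = lg x' by apply: (lvl_inj tN (Flvl x)); rewrite FE.
  by rewrite -(mk_nodeK x) -(mk_nodeK x') lE; apply: (act_free tN (ca _)); move: FE; rewrite /F lE.
have /choice[G GK] (y : N) : exists x, F x = y.
  have [a ya] := levels y; have [f ->] := transitive_levels (ca a) ya.
  by exists (mk_node a f).
have FK x : G (F x) = x by apply: Finj.
exists G; split; first by exists F.
- move=> s v; apply: Finj; rewrite GK (vec1 v) /=; move: (v ord0) => y {v}; set x := G y.
  have -> : y = F x by rewrite GK.
  case: s => [a b h|e] /=.
    rewrite -/(proj h (F x)); case: eqP => [xa|xa].
      by rewrite /F xa (proj_act tN) // cproj -/(F _) Fmk.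
    by apply: (proj_out tN) => xa'; apply: xa; exact: (lvl_inj tN (Flvl x)).
  rewrite -/(shift e (F x)); case: eqP => [xe|xe].
    rewrite /add_node Fmk /F xe -{1}[e]mk_nodeK -/(act _ _ _) (actD tN) //.
  by apply: (shift_out tN) => xe'; apply: xe; exact: (lvl_inj tN (Flvl x)).
- move=> [a] v /=; rewrite (vec1 v) -/(lvl a (v ord0)) -{1}[v ord0]GK.
  split=> [va|<-]; last exact: Flvl.
  exact: (lvl_inj tN (Flvl _)).
Qed.

End Coordinates.
End Uniqueness.

(** * The size of the language *)

Section Continuum.
Context {d : Order.disp_t} (W : orderType d) (hW : is_omega1 W).

Section NodeCode.
Context (k : W -> W -> nat).
Context (kinj : forall a c c', (c < a)%O -> (c' < a)%O -> k a c = k a c' -> c = c').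

(** The well-order below [lg x] and the set of ones of [x], transported to the natural numbers
    along the injection [k (lg x)]. *)
Definition node_code (x : node W) (q : nat * nat + nat) : bool :=
  match q with
  | inl (i, j) => `[< exists c c', [/\ (c < lg x)%O, (c' < lg x)%O,
                        k (lg x) c = i, k (lg x) c' = j & (c <= c')%O] >]
  | inr i => `[< exists c, [/\ (c < lg x)%O, k (lg x) c = i & value x c] >]
  end.

Lemma node_code_le x c c' : (c < lg x)%O -> (c' < lg x)%O ->
  node_code x (inl (k (lg x) c, k (lg x) c')) = (c <= c')%O.
Proof.
move=> cx cx'; apply/asboolP/idP => [[e [e' [ex ex' ke ke' ee']]]|cc'].
  by rewrite -(kinj ex cx ke) -(kinj ex' cx' ke').
by exists c, c'.
Qed.

Lemma node_code_value x c : (c < lg x)%O ->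
  node_code x (inr (k (lg x) c)) = value x c.
Proof.
move=> cx; apply/asboolP/idP => [[e [ex ke ve]]|vc]; last by exists c.
by rewrite -(kinj ex cx ke).
Qed.

Lemma node_code_position x y c : node_code x = node_code y -> (c < lg x)%O ->
  exists2 c', (c' < lg y)%O & k (lg y) c' = k (lg x) c.
Proof.
move=> xy cx; have := node_code_le cx cx; rewrite xy lexx => /asboolP[c' [_ [cy' _ kc' _ _]]].
by exists c'.
Qed.

(** An isomorphism between two initial segments of a well-order is the identity: otherwise,
    consider the first point [m] that is moved. *)
Lemma node_code_rigid x y : node_code x = node_code y ->
  forall c, (c < lg x)%O -> (c < lg y)%O /\ k (lg y) c = k (lg x) c.
Proof.
move=> xy c cx; apply: contrapT => nc.
have /(omega1_min hW)[{cx nc} m [mx +] mmin] : exists c, (c < lg x)%O /\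
    ~ ((c < lg y)%O /\ k (lg y) c = k (lg x) c) by exists c.
have IH e : (e < m)%O -> (e < lg y)%O /\ k (lg y) e = k (lg x) e.
  move=> em; apply: contrapT => ne; have := mmin e; rewrite leNgt em; move=> /(_ _)/negP.
  by apply=> //; split=> //; exact: lt_trans mx.
apply; have [m' my' km'] := node_code_position xy mx.
have [mm'|mm'|mE] := ltgtP m m'; last by subst m'.
  have my := lt_trans mm' my'.
  have [m'' mx'' km''] := node_code_position (esym xy) my.
  have le : (m'' <= m)%O.
    by rewrite -(node_code_le mx'' mx) xy km'' -km' node_code_le // ltW.
  have [mE|ne] := eqVneq m'' m.
    have E : m' = m by apply: (kinj my' my); rewrite km' -km'' mE.
    by move: mm'; rewrite E ltxx.
  have lt : (m'' < m)%O by rewrite lt_neqAle ne.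
  have [my'' ke] := IH m'' lt.
  by case/eqP: ne; apply: (kinj my'' my); rewrite ke.
have [_ ke] := IH m' mm'.
have E : m' = m by apply: (kinj (lt_trans mm' mx) mx); rewrite -ke.
by move: mm'; rewrite E ltxx.
Qed.

Lemma node_code_inj : injective node_code.
Proof.
have le x y : node_code x = node_code y -> (lg x <= lg y)%O.
  move=> xy; rewrite leNgt; apply/negP => /(node_code_rigid xy)[].
  by rewrite ltxx.
move=> x y xy; have lE : lg x = lg y by apply/le_anti; rewrite !le.
apply: node_ext => // c cx; have [cy kc] := node_code_rigid xy cx.
by rewrite -node_code_value // xy -kc node_code_value.
Qed.

End NodeCode.

(** Zero sequences stand for their lengths, so that only nodes remain to be coded. *)
Definition symbol_parts (s : symbols (tree_language W)) : nat * (node W * node W) :=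
  let zero (a : W) := mk_node a (fun=> false) in
  match s with
  | inl (Proj a b _) => (0, (zero a, zero b))
  | inl (Shift e) => (1, (e, e))
  | inr (U a) => (2, (zero a, zero a))
  end.

Lemma symbol_parts_inj : injective symbol_parts.
Proof.
move=> [[a b h|e]|[a]] [[a' b' h'|e']|[a']] //= E.
- have [aE bE] : a = a' /\ b = b'.
    by split; [exact: (congr1 (fun p => lg p.2.1) E)|exact: (congr1 (fun p => lg p.2.2) E)].
  by subst a' b'; rewrite (bool_irrelevance h h').
- by have := congr1 (fun p => p.2.1) E => /= ->.
- by have := congr1 (fun p => lg p.2.1) E; rewrite /lg /= => ->.
Qed.

Theorem tree_language_continuum :
  [set: symbols (tree_language W)] #= [set: nat -> bool].
Proof.
rewrite card_eq_le; apply/andP; split.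
  have /choice[k kP] (a : W) : exists f : W -> nat,
      forall c c', (c < a)%O -> (c' < a)%O -> f c = f c' -> c = c'.
    case: hW => _ /(_ a)/countable_injP[f finj] _; exists f => c c' ca ca'.
    by apply: finj; rewrite inE.
  have nodeK := node_code_inj kP.
  pose code (s : symbols (tree_language W)) (q : nat + bool * (nat * nat + nat)) : bool :=
    match q with
    | inl n => n == (symbol_parts s).1
    | inr (b, q) => node_code k (if b then (symbol_parts s).2.1 else (symbol_parts s).2.2) q
    end.
  apply: (@injective_card_le _ _
    (fun s n => if unpickle n is Some q then code s q else false)) => s t st.
  have {}st q : code s q = code t q.
    by have := congr1 (fun f => f (pickle q)) st; rewrite /= pickleK.
  apply: symbol_parts_inj.
  have := st (inl (symbol_parts s).1); rewrite /= eqxx => /esym/eqP.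
  have : (symbol_parts s).2.1 = (symbol_parts t).2.1.
    by apply: nodeK; apply/funext => q; exact: (st (inr (true, q))).
  have : (symbol_parts s).2.2 = (symbol_parts t).2.2.
    by apply: nodeK; apply/funext => q; exact: (st (inr (false, q))).
  by case: (symbol_parts s) => n [x y]; case: (symbol_parts t) => n' [x' y'] /= -> -> ->.
have [a] := infinite_set_bounded hW (omega1_infinite hW); rewrite setTI => inf_a.
have [o o_min] := omega1_bottom hW.
have [|F Finj _] := @continuum_many_nodes _ _ a o.
  by apply: sub_infinite_set inf_a => c /= ca; split.
by apply: (@injective_card_le _ _ (fun X => inl (Shift (mk_node a (F X))))) => X Y [/Finj].
Qed.

End Continuum.

Unset Implicit Arguments.

Theorem theorem3p1 (d : Order.disp_t) (W : orderType d) (hW : is_omega1 W) :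
  let T := Th (tree W) in
  [/\ [set: symbols (tree_language W)] #= [set: nat -> bool],
      atomic_model_of T (tree W),
      forall N : structure (tree_language W),
        atomic_model_of T N -> isomorphic N (tree W)
    & ~ prime_model_of T (tree W)].
Proof.
split.
- exact: tree_language_continuum.
- by split; last exact: tree_atomic.
- move=> N [NT atN]; apply: (tree_like_transitive_isomorphic hW).
  + exact: atomic_tree_like.
  + exact: atomic_level.
  + exact: atomic_transitive.
- by move=> [_]; exact: tree_not_prime.
Qed.
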